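(* Let $n$ be a positive integer, let $\alpha>0$, and let $f$ be a real polynomial with $f\in P_n([0,\alpha))$. For $k\ge0$ put $b_k=\frac{f^{(k+1)}(0)}{(k+1)!}$. (1) If $f\in P_{n+1}([0,\alpha))$, then there exists a Borel measure $\mu$ on $\mathbb{R}$ such that $b_k=\int_{\mathbb{R}}t^k\,d\mu$ for $0\le k\le 2n-1$. (2) If $f\in P_{n+1}([0,\alpha))$ and $M_{n+1}(f;0)>0$, then there exists a Borel measure $\mu$ on $\mathbb{R}$ such that $b_k=\int_{\mathbb{R}}t^k\,d\mu$ for $0\le k\le 2n$. (3) Let $r$ be the smallest positive integer such that the matrix $M_{r+1}(f;0)$ is not invertible. If $r<\operatorname{rank}(M_n(f;0))$, then $f\notin P_{n+1}([0,\alpha))$.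
   Context: Borel measures are non-negative. For a smooth function $f$ and a positive integer $m$, $M_m(f;t)=\left(\frac{f^{(i+j-1)}(t)}{(i+j-1)!}\right)_{i,j=1}^m$, so that $M_m(f;0)=(b_{i+j-2})_{i,j=1}^m$. For a Hermitian matrix, $>0$ means positive definite. For an interval $I$, $P_m(I)$ denotes the class of real-valued continuous functions $f:I\to\mathbb{R}$ that are matrix monotone of order $m$: for any self-adjoint $m\times m$ matrices $x,y$ with eigenvalues in $I$, $x\le y$ implies $f(x)\le f(y)$ (functional calculus; $x\le y$ means $y-x$ is positive semidefinite). *)

(* Defs.v *)
From HB Require Import structures.
From mathcomp Require Import all_boot all_order all_algebra.
From mathcomp Require Import sesquilinear spectral.
From mathcomp Require Import complex.
From mathcomp Require Import all_classical all_reals all_analysis.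

Set Implicit Arguments.
Unset Strict Implicit.
Unset Printing Implicit Defensive.

Import Order.TTheory GRing.Theory Num.Theory.
Import numFieldNormedType.Exports.

Local Open Scope classical_set_scope.
Local Open Scope ring_scope.
Local Open Scope sesquilinear_scope.

(* On [R[i]] the order [0 <= z] means that [z] is real and nonnegative. *)
Definition psdmx (R : realType) (m : nat) (A : 'M[R[i]]_m) : Prop :=
  A \is hermsymmx /\ forall u : 'rV[R[i]]_m, 0 <= (u *m A *m u ^t*) 0 0.

Definition pdmx (R : realType) (m : nat) (A : 'M[R[i]]_m) : Prop :=
  A \is hermsymmx /\
  forall u : 'rV[R[i]]_m, u != 0 -> 0 < (u *m A *m u ^t*) 0 0.

Definition lemx (R : realType) (m : nat) (x y : 'M[R[i]]_m) : Prop :=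
  psdmx (y - x).

Definition spectrum_in (R : realType) (m : nat) (I : interval R)
    (x : 'M[R[i]]_m) : Prop :=
  forall a : R[i], eigenvalue x a -> exists2 t : R, t \in I & a = t%:C%C.

(* For a self-adjoint [x], the library's spectral theorem reads
   [x = invmx U *m diag_mx d *m U] with [U = spectralmx x] unitary and
   [d = spectral_diag x] real, so that [complex.Re] only casts [d] to [R].
   The value is meaningful for self-adjoint [x] only. *)
Definition fun_calculus (R : realType) (m : nat) (f : R -> R)
    (x : 'M[R[i]]_m) : 'M[R[i]]_m :=
  invmx (spectralmx x)
  *m diag_mx (map_mx (fun z : R[i] => (f (complex.Re z))%:C%C)
                     (spectral_diag x))
  *m spectralmx x.

(* A function I -> R is encoded as a total function; only its values on [I]
   matter here. *)
Definition matrix_monotone (R : realType) (m : nat) (I : interval R)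
    (f : R -> R) : Prop :=
  {within [set` I], continuous f} /\
  forall x y : 'M[R[i]]_m,
    x \is hermsymmx -> y \is hermsymmx ->
    spectrum_in I x -> spectrum_in I y ->
    lemx x y -> lemx (fun_calculus f x) (fun_calculus f y).

(* Indices start at 0, hence the shift from i + j - 1 to i + j + 1. *)
Definition derivmx (R : realType) (m : nat) (f : R -> R) (t : R) : 'M[R]_m :=
  \matrix_(i < m, j < m) (derive1n (i + j + 1) f t / ((i + j + 1)`!)%:R).

Definition bcoef (R : realType) (f : R -> R) (k : nat) : R :=
  derive1n k.+1 f 0 / (k.+1`!)%:R.

(* [measurableTypeR R] carries the Borel sigma-algebra. *)
Definition has_moment (R : realType)
    (mu : {measure set (measurableTypeR R) -> \bar R}) (k : nat) (b : R) :
    Prop :=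
  mu.-integrable setT (fun t : measurableTypeR R => ((t : R) ^+ k)%:E) /\
  (\int[mu]_(t in setT) ((t : R) ^+ k)%:E = b%:E)%E.

(* Main.v *)
Require Import Defs.
From mathcomp Require Import all_boot all_order all_algebra.
From mathcomp Require Import sesquilinear spectral.
From mathcomp Require Import complex.
From mathcomp Require Import all_classical all_reals all_analysis.
From mathcomp Require Import measurable_realfun.
From mathcomp Require Import zify ring.

Set Implicit Arguments.
Unset Strict Implicit.
Unset Printing Implicit Defensive.

Import Order.TTheory GRing.Theory Num.Theory.
Import numFieldNormedType.Exports.

Local Open Scope classical_set_scope.
Local Open Scope ring_scope.
Local Open Scope sesquilinear_scope.

(** Write [b k] for the coefficient of ['X^k.+1] in [p], so that [derivmx m] at
    [0] is the Hankel matrix [(b (i + j))] of size [m].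

    Everything rests on one fact: if [p] is matrix monotone of order [N.+1] on an
    interval starting at [0], then the Hankel matrix of size [N.+1] is positive
    semidefinite ([matrix_monotone_hankel_ge0]).  To see it, perturb a diagonal
    matrix [S] of small distinct eigenvalues [e * i] by [s] times the rank one
    matrix [J] of ones.  Monotonicity makes [w p(S + s J) w^T] minimal at
    [s = 0] among small [s >= 0], so its derivative there is nonnegative.  Since the derivative of
    [X ^+ k] is the sum of the [X ^+ a * X' * X ^+ (k - 1 - a)] and [J] has rank
    one, this derivative is the sum of the [b (a + c) * t a * t c], where [t a]
    is the sum of the [w_i (e i)^a] ([loewner_form_ge0]).  Inverting a
    Vandermonde matrix, one chooses [w], depending on [e], so that
    [t 0, ..., t N] are prescribed numbers [u_0, ..., u_N] while [t a] for
    [a > N] is a polynomial in [e] vanishing at [0].  Letting [e] tend to [0]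
    leaves the Hankel form at [u].

    A semidefinite Hankel matrix [H] yields a measure by a truncated form of the
    Gelfand-Naimark-Segal construction ([hankel_measure]).  Let [K] be the
    Hankel matrix of the shifted sequence and assume [ker H] is in [ker K].
    Writing [H = B B^*], one finds a Hermitian [T], multiplication by the
    variable, which sends each row of [B] but the last to the next one and satisfies
    [B T B^* = K].  With [v] the first row of [B], the numbers [v T^k v^*] are
    the [b k] for all [k <= 2 * N.+1 - 1], and the spectral measure of [T] at
    [v] has these moments.  The kernel condition holds when the Hankel matrix
    one size larger is semidefinite ([hankel_shift_ker]), which gives (1), and
    when [H] is definite, which gives (2).

    For (3), a kernel vector of the Hankel matrix of size [r.+1] is a recurrence
    of order [d <= r] satisfied by [b]; semidefiniteness in size [n.+1]
    propagates it along the whole Hankel matrix of size [n], whose rank is then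
    at most [d] ([hankel_rank]). *)

(** * Atomic measures and their moments *)

Lemma weighted_dirac_moment (R : realType) (w : {nonneg R}) (t : R) k :
  has_moment (mscale w (dirac (t : measurableTypeR R))) k (w%:num * t ^+ k).
Proof.
have mX : measurable_fun [set: measurableTypeR R]
    (fun x : measurableTypeR R => ((x : R) ^+ k)%:E).
  by apply/measurable_EFinP; exact: exprn_measurable.
split.
  apply/integrableP; split=> //.
  rewrite ge0_integral_mscale //; last exact: measurableT_comp.
  rewrite integral_dirac //; last exact: measurableT_comp.
  by rewrite diracT mul1e -EFinM ltry.
rewrite integralE !ge0_integral_mscale //;
  [|exact: measurable_funeneg|exact: measurable_funepos].
rewrite !integral_dirac //; [|exact: measurable_funeneg|exact: measurable_funepos].
rewrite diracT !mul1e.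
rewrite funeposE funenegE -EFinN.
have [tk_ge0|/ltW tk_le0] := lerP 0 (t ^+ k).
  rewrite (max_l (_ : (0 <= (t ^+ k)%:E)%E)) ?lee_fin //.
  by rewrite max_r ?lee_fin ?oppr_le0 // mule0 sube0.
rewrite (max_r (_ : ((t ^+ k)%:E <= 0)%E)) ?lee_fin //.
by rewrite max_l ?lee_fin ?oppr_ge0 // mule0 sub0e -EFinM mulrN EFinN oppeK.
Qed.

Lemma finitely_atomic_moments (R : realType) (N : nat) (w t : 'I_N -> R) :
  (forall i, 0 <= w i) ->
  exists mu : {measure set (measurableTypeR R) -> \bar R},
    forall k, has_moment mu k (\sum_i w i * t i ^+ k).
Proof.
elim: N w t => [|N IHN] w t w_ge0.
  exists mzero => k; rewrite big_ord0; split; last exact: integral_measure_zero.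
  apply/integrableP; split; last by rewrite integral_measure_zero ltry.
  by apply/measurable_EFinP; exact: exprn_measurable.
have [mu mu_mom] := IHN (fun i => w (widen_ord (leqnSn N) i))
  (fun i => t (widen_ord (leqnSn N) i)) (fun i => w_ge0 _).
pose delta := mscale (NngNum (w_ge0 ord_max)) (dirac (t ord_max : measurableTypeR R)).
exists (measure_add mu delta) => k.
have [mu_int mu_val] := mu_mom k.
have [delta_int delta_val] := weighted_dirac_moment (NngNum (w_ge0 ord_max)) (t ord_max) k.
split; last first.
  by rewrite integral_measure_add //= mu_val delta_val -EFinD big_ord_recr.
have /integrableP[mX mu_fin] := mu_int; have /integrableP[_ delta_fin] := delta_int.
apply/integrableP; split=> //.
rewrite ge0_integral_measure_add //; last exact: measurableT_comp.
exact: lte_add_pinfty.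
Qed.

(** * From positive Hankel matrices to measures *)

Lemma adjmxM (C : numClosedFieldType) m n p (A : 'M[C]_(m, n))
    (B : 'M[C]_(n, p)) : (A *m B) ^t* = B ^t* *m A ^t*.
Proof. by rewrite trmx_mul map_mxM. Qed.

Lemma hermsymmx_adj (C : numClosedFieldType) n (A : 'M[C]_n) :
  (A \is hermsymmx) = (A == A ^t*).
Proof. by apply/is_hermitianmxP/eqP; rewrite expr0 scale1r. Qed.

Lemma hermsymmx_spectral (C : numClosedFieldType) n (A : 'M[C]_n) :
  A \is hermsymmx ->
  A = (spectralmx A) ^t* *m diag_mx (spectral_diag A) *m spectralmx A.
Proof.
move=> A_herm; have /orthomx_spectralP := hermitian_normalmx A_herm.
by rewrite invmx_unitary ?spectral_unitarymx.
Qed.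

(** The measure puts, at each eigenvalue of [T], the squared length of the
    component of [v] along the corresponding eigenvector. *)
Lemma spectral_measure (R : realType) (N : nat) (T : 'M[R[i]]_N.+1)
    (v : 'rV[R[i]]_N.+1) :
  T \is hermsymmx ->
  exists mu : {measure set (measurableTypeR R) -> \bar R},
    forall k c, (v *m T ^+ k *m v ^t*) 0 0 = c%:C%C -> has_moment mu k c.
Proof.
move=> T_herm.
pose P := spectralmx T; pose d := spectral_diag T; pose u := v *m P ^t*.
have d_real i : (complex.Re (d 0 i))%:C%C = d 0 i.
  exact/RRe_real/(mxOverP (hermitian_spectral_diag_real T_herm)).
pose w i := complex.Re (`|u 0 i| ^+ 2).
have w_real i : (w i)%:C%C = u 0 i * (u 0 i)^*.
  by rewrite -normCK RRe_real // rpredX // normr_real.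
have w_ge0 i : 0 <= w i by rewrite -ler0c w_real -normCK exprn_ge0.
have [mu mu_mom] := finitely_atomic_moments (fun i => complex.Re (d 0 i)) w_ge0.
exists mu => k c c_def.
suff -> : c = \sum_i w i * complex.Re (d 0 i) ^+ k by exact: mu_mom.
apply: (@complexI R); rewrite -c_def.
have -> : T ^+ k = P ^t* *m diag_mx (map_mx (horner 'X^k) d) *m P.
  rewrite -horner_mx_diag -invmx_unitary ?spectral_unitarymx //.
  rewrite -horner_mx_uconjC ?spectral_unit // invmx_unitary ?spectral_unitarymx //.
  by rewrite -hermsymmx_spectral // rmorphXn /= horner_mx_X.
have -> : v *m (P ^t* *m diag_mx (map_mx (horner 'X^k) d) *m P) *m v ^t*
   = u *m diag_mx (map_mx (horner 'X^k) d) *m u ^t*.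
  by rewrite /u adjmxM trmxCK !mulmxA.
rewrite rmorph_sum /= mxE; apply: eq_bigr => i _.
have -> : (u ^t*) i 0 = (u 0 i)^* by rewrite mxE [in LHS]mxE.
rewrite mul_mx_diag mxE. rewrite [(map_mx _ _) 0 i]mxE hornerXn.
by rewrite rmorphM rmorphXn /= w_real d_real mulrAC.
Qed.

Definition hankel (R : nzRingType) (N : nat) (b : nat -> R) : 'M[R]_N :=
  \matrix_(i, j) b (i + j)%N.

(** With [H = U^* D U], take [B = U^* D^(1/2)] and let [C] be [D^(-1/2) U].  As
    [0^-1 = 0], [C] is a pseudo-inverse of [B], so that [B C] is the orthogonal
    projection onto the range of [H]. *)
Lemma psdmx_gram (R : realType) (N : nat) (H : 'M[R[i]]_N) :
  psdmx H -> exists B C : 'M[R[i]]_N,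
    [/\ H = B *m B ^t*, B *m C *m H = H & B = H *m C ^t*].
Proof.
move=> [H_herm H_ge0].
pose U := spectralmx H; pose d := spectral_diag H.
pose s := map_mx sqrtC d; pose t := map_mx (fun x => (sqrtC x)^-1) d.
have Uu : U *m U ^t* = 1%:M by apply/unitarymxP/spectral_unitarymx.
have H_eq : H = U ^t* *m diag_mx d *m U by exact: hermsymmx_spectral.
have d_ge0 i : 0 <= d 0 i.
  have := H_ge0 (row i U); rewrite {1}H_eq.
  have -> : row i U *m (U ^t* *m diag_mx d *m U) *m (row i U) ^t* =
      row i (U *m U ^t*) *m diag_mx d *m (row i (U *m U ^t*)) ^t*.
    by rewrite !row_mul adjmxM trmxCK !mulmxA.
  rewrite Uu mul_mx_diag mxE (bigD1 i) //= !mxE eqxx big1 ?addr0.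
    by rewrite mulr1n mul1r conjC1 mulr1.
  by move=> j ji; rewrite !mxE eq_sym (negPf ji) mulr0n mul0r mul0r.
have s_herm : (diag_mx s) ^t* = diag_mx s.
  rewrite tr_diag_mx map_diag_mx; congr diag_mx; apply/rowP=> i; rewrite !mxE.
  by apply: geC0_conj; rewrite sqrtC_ge0.
have t_herm : (diag_mx t) ^t* = diag_mx t.
  rewrite tr_diag_mx map_diag_mx; congr diag_mx; apply/rowP=> i; rewrite !mxE.
  by apply: geC0_conj; rewrite invr_ge0 sqrtC_ge0.
have ss : diag_mx s *m diag_mx s = diag_mx d.
  rewrite mulmx_diag; congr diag_mx; apply/rowP=> i.
  by rewrite !mxE -expr2 sqrtCK.
have std : diag_mx s *m diag_mx t *m diag_mx d = diag_mx d.
  rewrite !mulmx_diag; congr diag_mx; apply/rowP=> i; rewrite !mxE.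
  have [->|d_neq0] := eqVneq (d 0 i) 0; first by rewrite mulr0.
  by rewrite divff ?mul1r // sqrtC_eq0.
have dt : diag_mx d *m diag_mx t = diag_mx s.
  rewrite !mulmx_diag; congr diag_mx; apply/rowP=> i; rewrite !mxE.
  have [->|d_neq0] := eqVneq (d 0 i) 0; first by rewrite sqrtC0 mul0r.
  by rewrite -{1}(sqrtCK (d 0 i)) expr2 mulfK // sqrtC_eq0.
exists (U ^t* *m diag_mx s), (diag_mx t *m U); split.
- by rewrite adjmxM trmxCK s_herm !mulmxA -(mulmxA (U ^t*) (diag_mx s)) ss -H_eq.
- rewrite {1}H_eq -!mulmxA (mulmxA U (U ^t*)) Uu mul1mx.
  by rewrite (mulmxA (diag_mx s)) (mulmxA (diag_mx s *m diag_mx t)) std mulmxA -H_eq.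
- by rewrite adjmxM t_herm {1}H_eq -!mulmxA (mulmxA U (U ^t*)) Uu mul1mx dt.
Qed.

(** [T = C K C^*] represents multiplication by the variable on polynomials of
    degree at most [N] modulo the kernel of [H]; [row i B] is the class of the
    monomial of degree [i].  The kernel hypothesis makes this well defined, and
    the moment of order [i + j + 1] is read off as the entry [(i, j)] of [K]. *)
Lemma hankel_measure (R : realType) (N : nat) (b : nat -> R)
    (H := hankel N.+1 (fun k => (b k)%:C%C))
    (K := hankel N.+1 (fun k => (b k.+1)%:C%C)) :
  psdmx H -> (forall u : 'rV[R[i]]_N.+1, u *m H = 0 -> u *m K = 0) ->
  exists mu : {measure set (measurableTypeR R) -> \bar R},
    forall k, (k <= 2 * N.+1 - 1)%N -> has_moment mu k (b k).
Proof.
move=> H_psd kerHK.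
have K_herm : K ^t* = K.
  by apply/matrixP=> i j; rewrite !mxE addnC; apply: conjc_real.
have [B [C [H_eq BCH B_eq]]] := psdmx_gram H_psd.
(* The rows of [1 - B C] lie in the kernel of [H], hence in that of [K]. *)
have BCK : B *m C *m K = K.
  apply/eqP; rewrite -subr_eq0 -[X in _ - X]mul1mx -mulmxBl; apply/eqP/row_matrixP.
  by move=> i; rewrite row_mul kerHK ?row0 // -row_mul mulmxBl BCH mul1mx subrr row0.
pose T := C *m K *m C ^t*.
have T_herm : T ^t* = T by rewrite !adjmxM trmxCK K_herm mulmxA.
have BT : B *m T = K *m C ^t* by rewrite !mulmxA BCK.
have BTB : B *m T *m B ^t* = K.
  by rewrite BT -mulmxA -adjmxM -[X in X *m _]K_herm -adjmxM BCK.
(* Row [i] of [K] is row [i.+1] of [H]: this is where the Hankel shape enters. *)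
have rowBT (i j : 'I_N.+1) : (i.+1 = j)%N -> row i B *m T = row j B.
  move=> ij; rewrite -row_mul BT B_eq !row_mul; congr (_ *m _).
  by apply/rowP=> l; rewrite !mxE -ij.
pose v := row 0 B.
have vT (i : 'I_N.+1) : v *m T ^+ i = row i B.
  case: i; elim=> [|i IHi] lti; first by rewrite mulmx1; congr row; apply: val_inj.
  by rewrite exprSr mulmxA (IHi (ltnW lti)); apply: rowBT.
have [mu mu_mom] : exists mu : {measure set (measurableTypeR R) -> \bar R},
    forall k c, (v *m T ^+ k *m v ^t*) 0 0 = c%:C%C -> has_moment mu k c.
  by apply: spectral_measure; rewrite hermsymmx_adj T_herm.
exists mu => k k_le; apply: mu_mom.
have row_adj (X Y : 'M[R[i]]_N.+1) i j : (row i X *m (row j Y) ^t*) 0 0 = (X *m Y ^t*) i j.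
  by rewrite !mxE; apply: eq_bigr => l _; rewrite !mxE.
case: k k_le => [|k] k_le.
  by rewrite mulmx1 row_adj -H_eq mxE.
have TX_herm l : (T ^+ l) ^t* = T ^+ l.
  elim: l => [|l IHl]; first by rewrite trmx1 map_mx1.
  by rewrite {1}exprS adjmxM IHl T_herm exprSr.
have [i [j ->]] : exists i j : 'I_N.+1, k = (i + j)%N.
  have kN : (k - N < N.+1)%N by lia.
  have [kN'|kN'] := leqP k N.
    by exists (inord k), 0; rewrite inordK ?addn0.
  by exists ord_max, (Ordinal kN) => /=; lia.
have -> : T ^+ (i + j).+1 = T ^+ i *m (T *m T ^+ j).
  by rewrite -addnS exprD exprS.
have -> : v *m (T ^+ i *m (T *m T ^+ j)) *m v ^t* =
    (v *m T ^+ i) *m T *m (v *m (T ^+ j) ^t*) ^t*.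
  by rewrite adjmxM trmxCK !mulmxA.
by rewrite TX_herm !vT -row_mul row_adj BTB mxE.
Qed.

(** * Semidefinite Hankel matrices: kernels and ranks *)

Lemma psdmx_ker (R : realType) (N : nat) (H : 'M[R[i]]_N) (u : 'rV[R[i]]_N) :
  psdmx H -> (u *m H *m u ^t*) 0 0 = 0 -> u *m H = 0.
Proof.
move=> /psdmx_gram[B [_ [H_eq _ _]]] uHu.
suff uB0 : u *m B = 0 by rewrite H_eq mulmxA uB0 mul0mx.
have : \sum_j `|(u *m B) 0 j| ^+ 2 = 0.
  rewrite -[RHS]uHu H_eq.
  have -> : u *m (B *m B ^t*) *m u ^t* = (u *m B) *m (u *m B) ^t*.
    by rewrite adjmxM !mulmxA.
  rewrite [RHS]mxE; apply: eq_bigr => j _.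
  by rewrite normCK [(_ ^t*) j 0]mxE [(_ ^T) j 0]mxE.
move=> /psumr_eq0P sum0; apply/rowP=> j; rewrite [RHS]mxE.
apply/eqP; rewrite -normr_eq0 -sqrf_eq0; exact/eqP/sum0.
Qed.

(** The cross terms between the real and the imaginary part of a vector cancel
    because [H] is symmetric. *)
Lemma psdmx_complexify (R : realType) (N : nat) (H : 'M[R]_N) :
  H^T = H -> (forall u : 'rV[R]_N, 0 <= (u *m H *m u^T) 0 0) ->
  psdmx (map_mx (real_complex R) H).
Proof.
move=> H_sym H_ge0; set Hc := map_mx _ H; split.
  rewrite hermsymmx_adj; apply/eqP/matrixP=> i j; rewrite !mxE.
  by rewrite -{1}H_sym mxE; apply/esym/conjc_real.
move=> u.
pose a := map_mx (@complex.Re R) u; pose b := map_mx (@complex.Im R) u.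
have Hc_sym : Hc^T = Hc by rewrite map_trmx H_sym.
pose ac := map_mx (real_complex R) a; pose bc := map_mx (real_complex R) b.
have u_eq : u = ac + 'i%C *: bc.
  by apply/rowP=> j; rewrite !mxE; apply: complexE.
have u_adj : u ^t* = ac^T - 'i%C *: bc^T.
  apply/matrixP=> i j; rewrite !mxE.
  case: (u j i) => x y; apply/eqP; rewrite eq_complex /=.
  by apply/andP; split; apply/eqP; ring.
have cross : (ac *m Hc *m bc^T) 0 0 = (bc *m Hc *m ac^T) 0 0.
  have tr00 (X : 'M[R[i]]_1) : X 0 0 = X^T 0 0 by rewrite mxE.
  by rewrite tr00 !trmx_mul trmxK Hc_sym mulmxA.
have realq (x : 'rV[R]_N) : (map_mx (real_complex R) x *m Hc
    *m (map_mx (real_complex R) x)^T) 0 0 = ((x *m H *m x^T) 0 0)%:C%C.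
  by rewrite map_trmx -!map_mxM mxE.
suff -> : (u *m Hc *m u ^t*) 0 0
    = (ac *m Hc *m ac^T) 0 0 + (bc *m Hc *m bc^T) 0 0.
  by rewrite !realq addr_ge0 // ler0c.
have ii : 'i%C * 'i%C = -1 :> R[i] by rewrite -expr2 sqr_i.
rewrite u_adj u_eq mulmxBr !mulmxDl -!scalemxAr -!scalemxAl.
move: cross; move: (ac *m Hc *m ac^T) (bc *m Hc *m bc^T) => A B.
move: (ac *m Hc *m bc^T) (bc *m Hc *m ac^T) => X Y XY.
rewrite !mxE XY (mulrA 'i%C 'i%C) ii; ring.
Qed.

Lemma hankel_tr (R : nzRingType) N (b : nat -> R) : (hankel N b)^T = hankel N b.
Proof. by apply/matrixP=> i j; rewrite !mxE addnC. Qed.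

Lemma map_hankel (R S : nzRingType) (f : {rmorphism R -> S}) N (b : nat -> R) :
  map_mx f (hankel N b) = hankel N (f \o b).
Proof. by apply/matrixP=> i j; rewrite !mxE. Qed.

(** A vector killed by the Hankel matrix of size [N], padded with a zero, is
    isotropic for the one of size [N.+1], hence killed by it.  Its last [N]
    coordinates there are those of the image under the shifted matrix. *)
Lemma hankel_shift_ker (R : realType) (N : nat) (b : nat -> R[i])
    (u : 'rV[R[i]]_N) :
  psdmx (hankel N.+1 b) -> u *m hankel N b = 0 ->
  u *m hankel N (fun k => b k.+1) = 0.
Proof.
move=> H_psd uH.
(* [rVpoly u] has zero coefficients from rank [N] on, which does the padding. *)
pose w : 'rV[R[i]]_N.+1 := \row_j (rVpoly u)`_j.
have w_sum (F : nat -> R[i]) : \sum_j w 0 j * F j = \sum_j u 0 j * F j.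
  rewrite big_ord_recr /= mxE coef_rVpoly insubF ?ltnn // mul0r addr0.
  by apply: eq_bigr => j _; rewrite mxE -[(widen_ord _ j : nat)]/(j : nat) coef_rVpoly_ord.
have uH_entry (l : nat) : (l < N)%N -> \sum_j u 0 j * b (j + l)%N = 0.
  move=> lN; have := congr1 (fun M : 'rV_N => M 0 (Ordinal lN)) uH.
  by rewrite !mxE => e; rewrite -[RHS]e; apply: eq_bigr => j _; rewrite mxE.
have wH : w *m hankel N.+1 b = 0.
  apply: psdmx_ker H_psd _; rewrite mxE.
  under eq_bigr => l _.
    rewrite mxE; under eq_bigr => j _ do rewrite [hankel _ _ _ _]mxE.
    rewrite (w_sum (fun j => b (j + l)%N)); over.
  rewrite big_ord_recr /= big1 ?add0r; last first.
    by move=> l _; rewrite uH_entry // mul0r.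
  by rewrite 3!mxE coef_rVpoly insubF ?ltnn // rmorph0 mulr0.
apply/rowP=> l; rewrite !mxE.
have := congr1 (fun M : 'rV_N.+1 => M 0 (lift ord0 l)) wH; rewrite !mxE.
under eq_bigr => j _ do rewrite [hankel _ _ _ _]mxE.
rewrite (w_sum (fun j => b (j + lift ord0 l)%N)) => e; rewrite -[RHS]e.
by apply: eq_bigr => j _; rewrite mxE lift0 addnS.
Qed.

(** Read a kernel vector of the matrix of size [r.+1] as a polynomial [c] of
    degree [d <= r].  If ['X^m * c] is in the kernel of the matrix of size
    [n.+1], then ['X^m.+1 * c] is isotropic, because its form with itself equals
    that of ['X^m * c] with ['X^m.+2 * c]; hence it is in the kernel too, as long
    as degrees stay below [n].  Each row of index at least [d] of the matrix of
    size [n] is thus a combination of the [d] preceding ones. *)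
Lemma hankel_rank (R : realType) (n r : nat) (b : nat -> R) :
  psdmx (map_mx (real_complex R) (hankel n.+1 b)) -> (r <= n)%N ->
  hankel r.+1 b \notin unitmx -> (\rank (hankel n b) <= r)%N.
Proof.
move=> H_psd rn H_sing.
have ker_real (u : 'rV[R]_n.+1) :
    (u *m hankel n.+1 b *m u^T) 0 0 = 0 -> u *m hankel n.+1 b = 0.
  move=> uHu; apply: (map_mx_inj (f := real_complex R)) => //.
  rewrite map_mxM map_mx0; apply: psdmx_ker H_psd _.
  have -> : (map_mx (real_complex R) u) ^t* = map_mx (real_complex R) u^T.
    by apply/matrixP=> i j; rewrite !mxE; apply: conjc_real.
  by rewrite -!map_mxM mxE uHu.
have [c0 c0_neq0 c0H] : exists2 c : 'rV[R]_r.+1, c != 0 & c *m hankel r.+1 b = 0.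
  move: H_sing; rewrite -row_free_unit -kermx_eq0 => /rowV0Pn[c c_ker c_neq0].
  by exists c => //; apply/sub_kermxP.
pose c := rVpoly c0.
have c_neq0 : c != 0.
  by apply: contraNneq c0_neq0 => c_eq0; rewrite -(rVpolyK c0) -/c c_eq0 linear0.
pose d := (size c).-1.
have dr : (d <= r)%N by rewrite /d -ltnS prednK ?size_poly // size_poly_gt0.
have cd_neq0 : c`_d != 0 by rewrite -/(lead_coef c) lead_coef_eq0.
(* [S i = 0] is the recurrence at [i]; [y m] is the row of coefficients of
   ['X^m * c]. *)
pose S i := \sum_(j < d.+1) c`_j * b (i + j)%N.
pose y m : 'rV[R]_n.+1 := \row_j ('X^m * c)`_j.
have y_sum m (F : nat -> R) : (m + d <= n)%N ->
    \sum_j y m 0 j * F j = \sum_(j < d.+1) c`_j * F (m + j)%N.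
  move=> mdn.
  have -> : \sum_j y m 0 j * F j = \sum_(0 <= j < n.+1) ('X^m * c)`_j * F j.
    by rewrite big_mkord; apply: eq_bigr => j _; rewrite mxE.
  rewrite (big_cat_nat _ (n := m)) //=; last by lia.
  rewrite big1_seq ?add0r; last first.
    by move=> j; rewrite mem_index_iota coefXnM => /andP[_ /andP[_ ->]]; rewrite mul0r.
  rewrite (big_cat_nat _ (n := (m + d.+1)%N)) //=; [|lia|lia].
  rewrite [X in _ + X]big1_seq ?addr0; last first.
    move=> j; rewrite mem_index_iota coefXnM => /andP[_ /andP[jm _]].
    rewrite ifN ?nth_default ?mul0r //; last first.
      by rewrite -leqNgt (leq_trans (leq_addr _ _) jm).
    by rewrite (leq_trans (leqSpred _)) // -/d -(addKn m d.+1) leq_sub2r.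
  rewrite -{1}[m]add0n big_addn addKn big_mkord; apply: eq_bigr => j _.
  by rewrite coefXnM addnK ltnNge leq_addl /= addnC.
have yH m (l : 'I_n.+1) : (m + d <= n)%N ->
    (y m *m hankel n.+1 b) 0 l = S (m + l)%N.
  move=> mdn; rewrite mxE.
  under eq_bigr => j _ do rewrite [hankel _ _ _ _]mxE.
  rewrite (y_sum m (fun j => b (j + l)%N)) //; apply: eq_bigr => j _.
  by rewrite addnAC.
have S_ext m : (m + d <= n)%N -> (forall j, (j <= d)%N -> S (m + (m + j))%N = 0) ->
    forall i, (i <= n)%N -> S (m + i)%N = 0.
  move=> mdn S0 i i_le; have <- := yH m (Ordinal (i_le : (i < n.+1)%N)) mdn.
  rewrite ker_real ?mxE //.
  under eq_bigr => l _ do rewrite yH // mulrC mxE.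
  rewrite (y_sum m (fun l => S (m + l)%N)) //.
  by rewrite big1 // => j _; rewrite S0 ?mulr0 // -ltnS.
have S0 m : (m + d < n)%N -> forall i, (i <= n)%N -> S (m + i)%N = 0.
  elim: m => [|m IHm] mdn.
    apply: S_ext => [|j jd]; first exact: ltnW.
    have jr : (j < r.+1)%N by rewrite ltnS (leq_trans jd).
    have := congr1 (fun M : 'rV_r.+1 => M 0 (Ordinal jr)) c0H; rewrite !mxE => e.
    rewrite -[RHS]e /S !add0n.
    rewrite (eq_bigr (fun k : 'I_r.+1 => c`_k * b (j + k)%N)); last first.
      by move=> k _; rewrite mxE coef_rVpoly_ord addnC.
    rewrite -(big_mkord xpredT (fun k => c`_k * b (j + k)%N)).
    rewrite -(big_mkord xpredT (fun k => c`_k * b (j + k)%N)).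
    rewrite [RHS](big_cat_nat _ (n := d.+1)) //= [X in _ = _ + X]big1_seq ?addr0 //.
    move=> k; rewrite mem_index_iota => /andP[_ /andP[dk _]].
    by rewrite nth_default ?mul0r // (leq_trans (leqSpred _)).
  apply: S_ext => [|j jd]; first exact: ltnW.
  by rewrite addSnnS; apply: IHm; lia.
pose B := \matrix_(i < d, j < n) b (i + j)%N.
suff : (hankel n b <= B)%MS.
  by move=> /mxrankS/leq_trans-> //; exact: leq_trans (rank_leq_row _) dr.
have rowB i : (i < n)%N -> (\row_(l < n) b (i + l)%N <= B)%MS.
  elim/ltn_ind: i => i IHi i_lt.
  have [i_d|d_i] := ltnP i d.
    by apply: (eq_row_sub (Ordinal i_d)); apply/rowP=> l; rewrite !mxE.
  suff -> : \row_(l < n) b (i + l)%N =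
      - (c`_d)^-1 *: \sum_(j < d) c`_j *: \row_(l < n) b (i - d + j + l)%N.
    by apply/scalemx_sub/summx_sub => j _; apply/scalemx_sub/IHi; have := ltn_ord j; lia.
  apply/rowP=> l; rewrite !mxE summxE.
  have := S0 (i - d)%N (ltac:(lia)) l (ltac:(have := ltn_ord l; lia)).
  rewrite /S big_ord_recr /= => /eqP; rewrite addrC addr_eq0 => /eqP cd_eq.
  have -> : b (i + l)%N = (c`_d)^-1 * (c`_d * b (i - d + l + d)%N).
    by rewrite mulKf //; congr b; lia.
  rewrite cd_eq mulrN mulNr; congr (- (_ * _)); apply: eq_bigr => j _.
  by rewrite !mxE addnAC.
apply/row_subP=> i; rewrite (_ : row i _ = \row_(l < n) b (i + l)%N) ?rowB //.
by apply/rowP=> l; rewrite !mxE.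
Qed.

(** * Polynomial functions of Hermitian matrices *)

(** This frees the argument from the spectral decomposition: along a line of
    matrices, [horner_mx] is a polynomial in the parameter. *)
Lemma fun_calculus_horner (R : realType) (N : nat) (p : {poly R})
    (x : 'M[R]_N.+1) :
  x^T = x ->
  fun_calculus (horner p) (map_mx (real_complex R) x)
  = map_mx (real_complex R) (horner_mx x p).
Proof.
move=> x_sym; set xc := map_mx _ x.
have xc_herm : xc \is hermsymmx.
  rewrite hermsymmx_adj; apply/eqP/matrixP=> i j; rewrite !mxE.
  by rewrite -{1}x_sym mxE; apply/esym/conjc_real.
have d_real i : (complex.Re (spectral_diag xc 0 i))%:C%C = spectral_diag xc 0 i.
  exact/RRe_real/(mxOverP (hermitian_spectral_diag_real xc_herm)).
have xc_eq := hermsymmx_spectral xc_herm.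
rewrite -invmx_unitary ?spectral_unitarymx // in xc_eq.
rewrite map_horner_mx -/xc /fun_calculus.
move: (spectralmx xc) (spectral_diag xc) (spectral_unit xc) d_real xc_eq.
move=> U d U_unit d_real ->; rewrite (horner_mx_uconjC _ _ U_unit) horner_mx_diag.
congr (_ *m diag_mx _ *m _); apply/rowP=> i.
by rewrite [LHS]mxE [RHS]mxE -[in RHS]d_real horner_map.
Qed.

(** * The test matrices *)

(** A diagonal matrix with distinct eigenvalues, so that a Vandermonde matrix can
    be inverted, plus a rank one perturbation, so that the derivative in [s]
    factors. *)
Definition test_mx (R : realType) (N : nat) (e s : R) : 'M[R]_N :=
  diag_mx (\row_i (e * i%:R)) + s *: const_mx 1.

Lemma test_mx_tr (R : realType) (N : nat) (e s : R) :
  (test_mx N e s)^T = test_mx N e s.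
Proof. by rewrite linearD linearZ /= tr_diag_mx trmx_const. Qed.

Lemma test_mx_row (R : realType) (N : nat) (e s : R) (v : 'rV[R[i]]_N) j :
  (v *m map_mx (real_complex R) (test_mx N e s)) 0 j =
  (e * j%:R)%:C%C * v 0 j + s%:C%C * \sum_i v 0 i.
Proof.
rewrite mxE (bigD1 j) //= [in RHS](bigD1 j) //=.
rewrite !mxE eqxx mulr1n mulr1 rmorphD /= mulrDr mulrDr.
rewrite -!addrA; congr (_ + _); first exact: mulrC.
rewrite mulrC; congr (_ + _); rewrite mulr_sumr; apply: eq_bigr => i ij.
by rewrite !mxE (negPf ij) mulr0n add0r mulr1 mulrC.
Qed.

Lemma test_mx_quad (R : realType) (N : nat) (e s : R) (v : 'rV[R[i]]_N) :
  (v *m map_mx (real_complex R) (test_mx N e s) *m v ^t*) 0 0 =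
  \sum_(i < N) (e * i%:R)%:C%C * `|v 0 i| ^+ 2 + s%:C%C * `|\sum_i v 0 i| ^+ 2.
Proof.
rewrite mxE; under eq_bigr => j _ do
  rewrite test_mx_row mulrDl [(v ^t*) j 0]mxE [(v ^T) j 0]mxE -mulrA -normCK.
rewrite big_split /=; congr (_ + _).
by rewrite -mulr_sumr -mulrA normCK rmorph_sum.
Qed.

(** Eigenvalues are nonnegative because the form is; they are bounded by
    comparing the [l^1] norms of the two sides of [v *m x = a *: v]. *)
Lemma test_mx_spectrum (R : realType) (N : nat) (alpha e s : R) :
  0 <= e -> 0 <= s -> (e + s) * N%:R < alpha ->
  spectrum_in `[0, alpha[ (map_mx (real_complex R) (test_mx N e s)).
Proof.
move=> e_ge0 s_ge0 es_lt a /eigenvalueP[v va v_neq0].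
have [i0 vi0] : exists i, v 0 i != 0.
  by apply/existsP; apply: contraNT v_neq0; rewrite negb_exists => /forallP v0;
    apply/eqP/rowP=> i; rewrite mxE; apply/eqP; have := v0 i; rewrite negbK.
have sum_gt0 (F : 'I_N -> R[i]) : (forall i, 0 <= F i) -> 0 < F i0 -> 0 < \sum_i F i.
  move=> F_ge0 F_gt0; rewrite (bigD1 i0) //= ltr_wpDr //.
  by apply: sumr_ge0.
have a_ge0 : 0 <= a.
  have V_gt0 : 0 < \sum_i `|v 0 i| ^+ 2.
    by apply: sum_gt0 => [i|]; rewrite ?exprn_ge0 // exprn_gt0 // normr_gt0.
  rewrite -(pmulr_lge0 _ V_gt0).
  have -> : a * (\sum_i `|v 0 i| ^+ 2) = (a *: v *m v ^t*) 0 0.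
    rewrite -scalemxAl mxE [X in _ = _ * X]mxE; congr (_ * _); apply: eq_bigr => i _.
    by rewrite normCK [(_ ^t*) i 0]mxE [(_ ^T) i 0]mxE.
  rewrite -va test_mx_quad; apply: addr_ge0.
    by apply: sumr_ge0 => i _; rewrite mulr_ge0 ?ler0c ?mulr_ge0 ?ler0n ?exprn_ge0.
  by rewrite mulr_ge0 ?ler0c ?exprn_ge0.
have a_real : (complex.Re a)%:C%C = a by apply: RRe_real; rewrite realE a_ge0.
have V_gt0 : 0 < \sum_i `|v 0 i| by apply: sum_gt0 => [i|]; rewrite ?normr_ge0 ?normr_gt0.
exists (complex.Re a) => //; rewrite in_itv /= -ler0c a_real a_ge0 /=.
apply: le_lt_trans es_lt; rewrite -lecR a_real -(ler_pM2r V_gt0).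
have -> : a * (\sum_i `|v 0 i|) = \sum_j `|(a *: v) 0 j|.
  by rewrite mulr_sumr; apply: eq_bigr => j _; rewrite mxE normrM ger0_norm.
set V := \sum_i `|v 0 i|.
have -> : ((e + s) * N%:R)%:C%C * V = \sum_(j < N) ((e * N%:R)%:C%C * `|v 0 j| + s%:C%C * V).
  rewrite big_split /= -mulr_sumr sumr_const card_ord -/V.
  by rewrite mulrDl rmorphD /= mulrDl; congr (_ + _);
    rewrite rmorphM rmorph_nat /= mulrAC mulr_natr.
apply: ler_sum => j _; rewrite -va test_mx_row.
apply: le_trans (ler_normD _ _) _; rewrite !normrM.
rewrite (ger0_norm (_ : 0 <= (e * j%:R)%:C%C))
  ?(ger0_norm (_ : 0 <= s%:C%C)) ?ler0c ?mulr_ge0 //.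
apply: lerD; last by rewrite ler_wpM2l ?ler0c // ler_norm_sum.
by rewrite ler_wpM2r // lecR ler_wpM2l // ler_nat ltnW.
Qed.

Lemma test_mx_monotone (R : realType) (N : nat) (alpha e s : R) (p : {poly R})
    (w : 'rV[R]_N.+1) :
  matrix_monotone N.+1 `[0, alpha[ (horner p) ->
  0 <= e -> 0 <= s -> (e + s) * N.+1%:R < alpha ->
  (w *m horner_mx (test_mx N.+1 e 0) p *m w^T) 0 0 <=
  (w *m horner_mx (test_mx N.+1 e s) p *m w^T) 0 0.
Proof.
move=> [_ p_mon] e_ge0 s_ge0 es_lt.
have test_herm a t : map_mx (real_complex R) (test_mx N.+1 a t) \is hermsymmx.
  rewrite hermsymmx_adj; apply/eqP/matrixP=> i j.
  by rewrite -{1}test_mx_tr !mxE; apply/esym/conjc_real.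
have e0_lt : (e + 0) * N.+1%:R < alpha.
  by apply: le_lt_trans es_lt; rewrite ler_wpM2r // lerD2l.
have test_le : lemx (map_mx (real_complex R) (test_mx N.+1 e 0))
    (map_mx (real_complex R) (test_mx N.+1 e s)).
  have -> : lemx (map_mx (real_complex R) (test_mx N.+1 e 0))
      (map_mx (real_complex R) (test_mx N.+1 e s))
      = psdmx (map_mx (real_complex R) (test_mx N.+1 0 s)).
    congr psdmx; rewrite -map_mxB; congr map_mx.
    by apply/matrixP=> i j; rewrite !mxE !mul0r mul0rn; move: (e * i%:R *+ _) => z; ring.
  split; first exact: test_herm.
  move=> u; rewrite test_mx_quad addr_ge0 //; last by rewrite mulr_ge0 ?ler0c ?exprn_ge0.
  by apply: sumr_ge0 => i _; rewrite mul0r mul0r.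
have [_ /(_ (map_mx (real_complex R) w))] := p_mon _ _ (test_herm e 0) (test_herm e s)
  (test_mx_spectrum e_ge0 (lexx 0) e0_lt) (test_mx_spectrum e_ge0 s_ge0 es_lt) test_le.
rewrite !fun_calculus_horner ?test_mx_tr // -map_mxB.
have -> : (map_mx (real_complex R) w) ^t* = map_mx (real_complex R) w^T.
  by apply/matrixP=> i j; rewrite !mxE; apply: conjc_real.
have sub00 (X Y : 'M[R]_1) : (X - Y) 0 0 = X 0 0 - Y 0 0 by rewrite !mxE.
by rewrite -!map_mxM mxE ler0c mulmxBr mulmxBl sub00 subr_ge0.
Qed.

(** * One-sided limits and derivatives of polynomials *)

Lemma horner0_ge0 (R : realType) (F : {poly R}) (d : R) :
  0 < d -> (forall s, 0 < s -> s < d -> 0 <= F.[s]) -> 0 <= F.[0].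
Proof.
move=> d_gt0 F_ge0.
have F_cvg : F.[x] @[x --> 0^'+] --> F.[0].
  by apply: cvg_at_right_filter; exact: continuous_horner.
rewrite -(cvg_lim _ F_cvg) //; apply: limr_ge; first by apply/cvg_ex; exists F.[0].
near=> x; apply: F_ge0; near: x; first exact: nbhs_right_gt.
exact: nbhs_right_lt.
Unshelve. all: by end_near. Qed.

Lemma deriv0_ge0 (R : realType) (q : {poly R}) (d : R) :
  0 < d -> (forall s, 0 < s -> s < d -> q.[0] <= q.[s]) -> 0 <= q^`().[0].
Proof.
move=> d_gt0 q_ge.
have /factor_theorem[g g_eq] : root (q - q.[0]%:P) 0 by rewrite rootE !hornerE subrr.
have -> : q^`().[0] = g.[0].
  rewrite -[q](subrK q.[0]%:P) g_eq derivD derivC addr0 derivM derivXsubC.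
  by rewrite !hornerE oppr0 mulr0 add0r.
apply: (horner0_ge0 d_gt0) => s s_gt0 s_lt.
rewrite -(pmulr_lge0 _ s_gt0); have := congr1 (horner^~ s) g_eq; rewrite !hornerE subr0 => <-.
by rewrite subr_ge0 q_ge.
Qed.

(** * The derivative of a polynomial along a line of matrices *)

Lemma deriv_mulmx (R : comNzRingType) m n k (A : 'M[{poly R}]_(m, n))
    (B : 'M[{poly R}]_(n, k)) :
  map_mx deriv (A *m B) = map_mx deriv A *m B + A *m map_mx deriv B.
Proof.
apply/matrixP=> i j; rewrite !mxE raddf_sum -big_split; apply: eq_bigr => l _ /=.
by rewrite !mxE derivM.
Qed.

Lemma deriv_mx_exp (R : comNzRingType) N (A : 'M[{poly R}]_N.+1) k :
  map_mx deriv (A ^+ k)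
  = \sum_(a < k) A ^+ a *m map_mx deriv A *m A ^+ (k.-1 - a).
Proof.
elim: k => [|k IHk].
  by rewrite big_ord0; apply/matrixP=> i j; rewrite !mxE -polyC_natr derivC.
rewrite exprSr deriv_mulmx IHk big_ord_recr /= subnn expr0 mulmx1.
congr (_ + _); rewrite mulmx_suml; apply: eq_bigr => a _.
rewrite -mulmxA -[X in _ *m X]exprSr; congr (_ *m _ ^+ _).
by have := ltn_ord a; lia.
Qed.

Lemma horner_mx_sum (R : comNzRingType) N (A : 'M[R]_N.+1) (p : {poly R}) M :
  (size p <= M)%N -> horner_mx A p = \sum_(k < M) p`_k *: A ^+ k.
Proof.
move=> pM; have {1}-> : p = \sum_(k < M) p`_k *: 'X^k.
  rewrite -[p in LHS]coefK poly_def (big_ord_widen M (fun k => p`_k *: 'X^k)) //.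
  rewrite big_mkcond; apply: eq_bigr => k _; case: ltnP => // ?.
  by rewrite nth_default // scale0r.
by rewrite linear_sum; apply: eq_bigr => k _; rewrite linearZ rmorphXn /= horner_mx_X.
Qed.

(** * The Hankel matrix of a matrix monotone polynomial *)

(** This is the derivative at [s = 0] of the quadratic form of [p] at
    [test_mx N.+1 e s], evaluated at [w].  It is also the value at [w] of the form whose
    matrix is the Loewner matrix of the divided differences of [p] at the points
    [e * i]. *)
Lemma loewner_form_ge0 (R : realType) (N : nat) (alpha e : R) (p : {poly R})
    (w : 'rV[R]_N.+1) (t := fun a => \sum_(i < N.+1) w 0 i * (e * i%:R) ^+ a) :
  matrix_monotone N.+1 `[0, alpha[ (horner p) ->
  0 <= e -> e * N.+1%:R < alpha ->
  0 <= \sum_(m < size p) p`_m.+1 * \sum_(a < m.+1) t a * t (m - a)%N.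
Proof.
move=> p_mon e_ge0 e_lt.
pose S := test_mx N.+1 e 0; pose one : 'M[R]_N.+1 := const_mx 1.
(* The line of matrices, with the parameter [s] as polynomial variable. *)
pose P : 'M[{poly R}]_N.+1 := map_mx polyC S + 'X *: const_mx 1.
have P_eval s : map_mx (horner_eval s) P = test_mx N.+1 e s.
  by apply/matrixP=> i j; rewrite !mxE /horner_eval !hornerE.
have P_deriv : map_mx deriv P = const_mx 1.
  by apply/matrixP=> i j; rewrite !mxE derivD derivC add0r mulr1 derivX.
have polyC_eval s m n (A : 'M[R]_(m, n)) :
    map_mx (horner_eval s) (map_mx polyC A) = A.
  by apply/matrixP=> i j; rewrite !mxE /horner_eval hornerC.
have polyC_deriv m n (A : 'M[R]_(m, n)) : map_mx deriv (map_mx polyC A) = 0.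
  by apply/matrixP=> i j; rewrite !mxE derivC.
pose q k := (map_mx polyC w *m P ^+ k *m map_mx polyC w^T) 0 0.
pose Q := \sum_(k < (size p).+1) p`_k *: q k.
have q_eval k s : (q k).[s] = (w *m test_mx N.+1 e s ^+ k *m w^T) 0 0.
  have -> : (q k).[s] = (map_mx (horner_eval s)
      (map_mx polyC w *m P ^+ k *m map_mx polyC w^T)) 0 0 by rewrite [RHS]mxE.
  by rewrite !map_mxM !polyC_eval rmorphXn /= P_eval.
have Q_eval s : Q.[s] = (w *m horner_mx (test_mx N.+1 e s) p *m w^T) 0 0.
  rewrite (horner_mx_sum _ (leqnSn (size p))) mulmx_sumr mulmx_suml summxE.
  rewrite horner_sum; apply: eq_bigr => k _.
  by rewrite hornerZ q_eval -scalemxAr -scalemxAl [RHS]mxE.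
have S_exp a : S ^+ a = diag_mx (\row_i (e * i%:R) ^+ a).
  have -> : S ^+ a = horner_mx S 'X^a by rewrite rmorphXn /= horner_mx_X.
  rewrite /S /test_mx scale0r addr0 horner_mx_diag.
  by congr diag_mx; apply/rowP=> i; rewrite !mxE hornerXn.
have tl a : (w *m S ^+ a *m (const_mx 1 : 'cV_N.+1)) 0 0 = t a.
  rewrite S_exp mul_mx_diag mxE; apply: eq_bigr => i _.
  by rewrite !mxE mulr1.
have tr a : ((const_mx 1 : 'rV_N.+1) *m S ^+ a *m w^T) 0 0 = t a.
  rewrite S_exp mul_mx_diag mxE; apply: eq_bigr => i _.
  by rewrite !mxE mul1r mulrC.
have oneE : (const_mx 1 : 'M[R]_N.+1) = (const_mx 1 : 'cV_N.+1) *m (const_mx 1 : 'rV_N.+1).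
  by apply/matrixP=> i j; rewrite !mxE big_ord1 !mxE mulr1.
have q_deriv k : (q k)^`().[0] = \sum_(a < k) t a * t (k.-1 - a)%N.
  have -> : (q k)^`().[0] = (map_mx (horner_eval 0) (map_mx deriv
      (map_mx polyC w *m P ^+ k *m map_mx polyC w^T))) 0 0.
    by rewrite [RHS]mxE [X in _ = horner_eval _ X]mxE.
  rewrite !deriv_mulmx !polyC_deriv mulmx0 addr0 mul0mx add0r !map_mxM !polyC_eval.
  rewrite deriv_mx_exp raddf_sum /= mulmx_sumr mulmx_suml summxE.
  apply: eq_bigr => a _.
  rewrite !map_mxM !rmorphXn /= P_eval P_deriv map_const_mx.
  rewrite /horner_eval hornerC oneE -/S -!mulmxA mulmxA mulmxA [LHS]mxE big_ord1.
  by rewrite tl mulmxA tr.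
suff : 0 <= Q^`().[0].
  rewrite /Q raddf_sum /= horner_sum big_ord_recl /= derivZ hornerZ q_deriv big_ord0.
  rewrite mulr0 add0r; congr (0 <= _); apply: eq_bigr => m _.
  by rewrite derivZ hornerZ q_deriv.
have N_gt0 : 0 < N.+1%:R :> R by rewrite ltr0n.
apply: (@deriv0_ge0 _ _ (alpha / N.+1%:R - e)) => [|s s_gt0 s_lt].
  by rewrite subr_gt0 ltr_pdivlMr.
rewrite !Q_eval; apply: (test_mx_monotone _ p_mon) => //; first exact: ltW.
by rewrite -ltr_pdivlMr // addrC -ltrBrDr.
Qed.

(** Taking [w_i] as the sum over [a] of [W i a * u_a / e ^+ a], with [W] the
    inverse Vandermonde matrix, turns the [t c] of [loewner_form_ge0] into
    [tau c], which is the constant [u_c] for [c <= N] and has only positive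
    powers of [e] for [c > N].  At [e = 0] only the Hankel form at [u] is left. *)
Lemma matrix_monotone_hankel_ge0 (R : realType) (N : nat) (alpha : R)
    (p : {poly R}) (u : 'rV[R]_N.+1) :
  0 < alpha -> matrix_monotone N.+1 `[0, alpha[ (horner p) ->
  0 <= (u *m hankel N.+1 (fun k => p`_k.+1) *m u^T) 0 0.
Proof.
move=> alpha_gt0 p_mon.
pose V : 'M[R]_N.+1 := Vandermonde N.+1 (\row_i i%:R).
have V_unit : V \in unitmx.
  rewrite unitmxE det_Vandermonde unitfE; apply/prodf_neq0 => i _.
  apply/prodf_neq0 => j ij; rewrite !mxE subr_eq0 eqr_nat.
  by rewrite neq_ltn ij orbT.
pose W := invmx V.
pose kappa c a := \sum_(i < N.+1) i%:R ^+ c * W i a.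
have kappa_delta (c : 'I_N.+1) a : kappa c a = (c == a)%:R.
  have := congr1 (fun M : 'M[R]_N.+1 => M c a) (mulmxV V_unit).
  by rewrite !mxE => <-; apply: eq_bigr => i _; rewrite !mxE.
(* For [c <= N], [kappa c a] vanishes unless [a = c], so the truncation of
   [c - a] at [0] is harmless. *)
pose tau c : {poly R} := \sum_(a < N.+1) (kappa c a * u 0 a) *: 'X^(c - a).
pose F := \sum_(m < size p) p`_m.+1 *: \sum_(a < m.+1) tau a * tau (m - a)%N.
have tau_eval e c : 0 < e -> (tau c).[e] =
    \sum_(i < N.+1) (\sum_(a < N.+1) W i a * (u 0 a * (e ^+ a)^-1)) * (e * i%:R) ^+ c.
  move=> e_gt0; rewrite horner_sum.
  under [RHS]eq_bigr => i _ do rewrite mulr_suml.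
  rewrite exchange_big /=; apply: eq_bigr => a _.
  rewrite hornerZ hornerXn.
  have -> : \sum_(i < N.+1) W i a * (u 0 a * (e ^+ a)^-1) * (e * i%:R) ^+ c
      = kappa c a * u 0 a * (e ^+ c * (e ^+ a)^-1).
    rewrite /kappa !mulr_suml; apply: eq_bigr => i _.
    by rewrite exprMn; ring.
  have [cN|cN] := ltnP c N.+1.
    rewrite (kappa_delta (Ordinal cN)) -val_eqE /=.
    have [->|_] := eqVneq c a; last by rewrite !mul0r.
    by rewrite subnn expr0 divff // expf_neq0 // gt_eqF.
  rewrite expfB_cond // gt_eqF // add0n.
  by rewrite (leq_trans _ (ltnW cN)) // -ltnS.
have F_ge0 e : 0 < e -> e < alpha / N.+1%:R -> 0 <= F.[e].
  move=> e_gt0 e_lt; pose w := \row_i \sum_(a < N.+1) W i a * (u 0 a * (e ^+ a)^-1).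
  have -> : F.[e] = \sum_(m < size p) p`_m.+1 * \sum_(a < m.+1)
      (\sum_(i < N.+1) w 0 i * (e * i%:R) ^+ a)
      * (\sum_(i < N.+1) w 0 i * (e * i%:R) ^+ (m - a)).
    rewrite horner_sum; apply: eq_bigr => m _; rewrite hornerZ horner_sum.
    congr (_ * _); apply: eq_bigr => a _; rewrite hornerM !tau_eval //.
    by congr (_ * _); apply: eq_bigr => i _; rewrite mxE.
  apply: (loewner_form_ge0 _ p_mon); first exact: ltW.
  by rewrite -ltr_pdivlMr // ltr0n.
have := horner0_ge0 (divr_gt0 alpha_gt0 (ltr0Sn R N)) F_ge0.
(* Generating polynomial of [u]: the convolution of [u] with itself is then the
   coefficient sequence of [G * G]. *)
pose G := \poly_(a < N.+1) u 0 (inord a).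
have tau0 c : (tau c).[0] = G`_c.
  rewrite horner_sum coef_poly; case: ltnP => cN.
    rewrite (bigD1 (Ordinal cN)) //= (kappa_delta (Ordinal cN)) eqxx big1.
      rewrite addr0 mul1r subnn expr0 hornerZ hornerC mulr1; congr (u 0 _).
      by apply: val_inj; rewrite /= inordK.
    move=> a; rewrite -val_eqE /= => ac.
    by rewrite (kappa_delta (Ordinal cN)) -val_eqE /= eq_sym (negPf ac)
      mul0r scale0r horner0.
  apply: big1 => a _; rewrite hornerZ hornerXn expr0n.
  by rewrite subn_eq0 leqNgt (leq_trans (ltn_ord a) cN) mulr0.
have -> : F.[0] = \sum_(m < size p) p`_m.+1 * (G * G)`_m.
  rewrite horner_sum; apply: eq_bigr => m _; rewrite hornerZ horner_sum coefM.
  by congr (_ * _); apply: eq_bigr => a _; rewrite hornerM !tau0.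
have GG m : (G * G)`_m = \sum_(i < N.+1) \sum_(j < N.+1) u 0 i * u 0 j * (m == i + j)%N%:R.
  rewrite /G poly_def mulr_suml coef_sum; apply: eq_bigr => i _.
  rewrite mulr_sumr coef_sum; apply: eq_bigr => j _.
  by rewrite -scalerAl -scalerAr scalerA -exprD coefZ coefXn !inord_val.
suff <- : \sum_(m < size p) p`_m.+1 * (G * G)`_m
    = (u *m hankel N.+1 (fun k => p`_k.+1) *m u^T) 0 0 by [].
under eq_bigr => m _ do rewrite GG mulr_sumr.
rewrite exchange_big mxE [RHS]big_mkcond /=.
rewrite (eq_bigr (fun j : 'I_N.+1 =>
  \sum_(i < N.+1) u 0 j * u 0 i * p`_(i + j).+1)); last first.
  move=> i _; under eq_bigr => m _ do rewrite mulr_sumr.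
  rewrite exchange_big; apply: eq_bigr => j _ /=.
  have [ij|ij] := ltnP (i + j) (size p).
    rewrite (bigD1 (Ordinal ij)) //= eqxx big1 ?addr0 ?mulr1; first by rewrite mulrC addnC.
    by move=> m; rewrite -val_eqE /= => /negPf->; rewrite !mulr0.
  rewrite nth_default ?mulr0; last by rewrite addnC (leq_trans ij).
  apply: big1 => m _; rewrite (_ : (m == i + j :> nat)%N = false) ?mulr0 //.
  by apply/negbTE; rewrite neq_ltn (leq_trans (ltn_ord m) ij).
apply: eq_bigr => j _; rewrite mxE mulr_suml; apply: eq_bigr => i _.
by rewrite !mxE; ring.
Qed.

Lemma matrix_monotone_hankel_psd (R : realType) (N : nat) (alpha : R)
    (p : {poly R}) :
  0 < alpha -> matrix_monotone N.+1 `[0, alpha[ (horner p) ->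
  psdmx (map_mx (real_complex R) (hankel N.+1 (fun k => p`_k.+1))).
Proof.
move=> alpha_gt0 p_mon; apply: psdmx_complexify; first exact: hankel_tr.
by move=> u; apply: matrix_monotone_hankel_ge0 p_mon.
Qed.

Lemma derive1n_horner0 (R : realType) (p : {poly R}) k :
  derive1n k (horner p) 0 / (k`!)%:R = p`_k.
Proof.
have -> : derive1n k (horner p) = horner p^`(k).
  by elim: k => [|k IHk]; rewrite ?derivn0 // derive1nS IHk derivnS derivE.
rewrite nderivn_def hornerMn horner_coef0 coef_nderivn addn0 binn mulr1n.
by rewrite -mulr_natr mulfK // pnatr_eq0 -lt0n fact_gt0.
Qed.

Lemma derivmx_hankel (R : realType) (p : {poly R}) m :
  derivmx m (horner p) 0 = hankel m (fun k => p`_k.+1).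
Proof. by apply/matrixP=> i j; rewrite !mxE derive1n_horner0 addn1. Qed.

Theorem theorem3p3 (R : realType) (n : nat) (n_gt0 : (0 < n)%N)
    (alpha : R) (alpha_gt0 : 0 < alpha) (p : {poly R})
    (p_mon : matrix_monotone n `[0, alpha[ (horner p)) :
  [/\ matrix_monotone n.+1 `[0, alpha[ (horner p) ->
      exists mu : {measure set (measurableTypeR R) -> \bar R},
        forall k : nat, (k <= 2 * n - 1)%N ->
          has_moment mu k (bcoef (horner p) k),
      matrix_monotone n.+1 `[0, alpha[ (horner p) ->
      pdmx (map_mx (real_complex R) (derivmx n.+1 (horner p) 0)) ->
      exists mu : {measure set (measurableTypeR R) -> \bar R},
        forall k : nat, (k <= 2 * n)%N ->
          has_moment mu k (bcoef (horner p) k)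
    & forall r : nat,
        (0 < r)%N ->
        derivmx r.+1 (horner p) 0 \notin unitmx ->
        (forall s : nat, (0 < s < r)%N ->
          derivmx s.+1 (horner p) 0 \in unitmx) ->
        (r < \rank (derivmx n (horner p) 0))%N ->
        ~ matrix_monotone n.+1 `[0, alpha[ (horner p)].
Proof.
pose b k := p`_k.+1.
have bcoefE k : bcoef (horner p) k = b k by apply: derive1n_horner0.
case: n n_gt0 p_mon => [|n'] // _ p_mon'.
have psd1 : matrix_monotone n'.+2 `[0, alpha[ (horner p) ->
    psdmx (map_mx (real_complex R) (hankel n'.+2 b)).
  exact: matrix_monotone_hankel_psd.
split.
- move=> /psd1 H_psd.
  have [||mu mu_mom] := @hankel_measure R n' b.
  + by have := matrix_monotone_hankel_psd alpha_gt0 p_mon'; rewrite map_hankel.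
  + by move=> u; apply: hankel_shift_ker; rewrite map_hankel in H_psd.
  + by exists mu => k k_le; rewrite bcoefE; apply: mu_mom.
- move=> /psd1 H_psd; rewrite derivmx_hankel => -[_ H_pd].
  have [||mu mu_mom] := @hankel_measure R n'.+1 b.
  + by rewrite map_hankel in H_psd.
  + move=> u uH; have [->|/H_pd] := eqVneq u 0; first by rewrite mul0mx.
    by rewrite map_hankel uH mul0mx mxE ltxx.
  + by exists mu => k k_le; rewrite bcoefE; apply: mu_mom; lia.
- move=> r _ + _ r_lt /psd1 H_psd; rewrite !derivmx_hankel in r_lt * => H_sing.
  have rn : (r <= n'.+1)%N by rewrite ltnW // (leq_trans r_lt) // rank_leq_row.
  by have := hankel_rank H_psd rn H_sing; rewrite leqNgt r_lt.
Qed.
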